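(* The following is a theorem of INF. Let $u,m\in\mathbb{N}$ be Church numbers such that $u\oplus m=u$. Let $X$ be any set and let $f:X\to X$ be an injection. Then $f$, iterated $m$ times, is the identity on $X$: for all $x\in X$, $m f x=x$ (where $mfx$ means $Ap(Ap(m,f),x)$).
   Context: INF (intuitionistic New Foundations) is the first-order theory with equality over intuitionistic logic, with one binary predicate $\in$, whose axioms are extensionality ($\forall z(z\in x\leftrightarrow z\in y)\to x=y$) and stratified comprehension (the set $\{x:\varphi\}$ exists for every stratified $\varphi$, parameters allowed; $\varphi$ is stratified if its variables can be assigned natural-number indices so that in each subformula $x\in y$ the index of $y$ is one more than that of $x$, and in each $x=y$ the indices agree). Ordered pairs are $\langle x,y\rangle=\{\{x\},\{x,y\}\}$. $\mathrm{FUNC}=\{f:\forall x,y,z(\langle x,y\rangle\in f\to\langle x,z\rangle\in f\to y=z)\}$; $Rel(f)$ means all members of $f$ are ordered pairs. Application: $Ap(f,x)=\{t:\exists y(\langle x,y\rangle\in f\land t\in y)\}$, so $Ap(f,x)=y$ if $f\in\mathrm{FUNC}$ and $\langle x,y\rangle\in f$. Write $fx$ or $f(x)$ for $Ap(f,x)$, associating to the left. Church numbers: $\mathbf{0}=\{\langle f,\mathrm{id}\rangle: f=f\}$ with $\mathrm{id}=\{\langle x,x\rangle:x=x\}$. Church successor is the set of all pairs $\langle z,s_z\rangle$ with $z\in\mathrm{FUNC}$, where $s_z$ is the set of all $\langle f,p\rangle$ with $f\in\mathrm{FUNC}$ and $\forall u\,(u\in p\leftrightarrow\exists x,w,t,q\,(u=\langle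 x,w\rangle\land t\in\mathrm{FUNC}\land\langle f,t\rangle\in z\land\langle x,q\rangle\in t\land\langle q,w\rangle\in f))$; it is denoted $\mathsf{S}$. (Thus $\mathsf{S}nfx=f(nfx)$ in the expected situations.) $\mathbb{N}$ is the intersection of all sets containing $\mathbf{0}$ and closed under $\mathsf{S}$. Addition on $\mathbb{N}$: with ordered triples $\langle x,y,z\rangle$, $Sum$ is the intersection of all sets $X$ such that $\langle x,\mathbf{0},x\rangle\in X$ for all $x\in\mathbb{N}$ and, for $x,n,y\in\mathbb{N}$, $\langle x,n,y\rangle\in X\to\langle x,\mathsf{S}n,\mathsf{S}y\rangle\in X$; $x\oplus n$ is the unique $y\in\mathbb N$ with $\langle x,n,y\rangle\in Sum$ (it satisfies $x\oplus\mathbf{0}=x$, $x\oplus\mathsf{S}n=\mathsf{S}(x\oplus n)$). $f:X\to Y$ means: for every $x\in X$ there is a unique $y$ with $\langle x,y\rangle\in f$, and this $y$ is in $Y$. $f:X\to X$ is an injection if $f:X\to X$, $Rel(f)$, $f\in\mathrm{FUNC}$, $dom(f)\subseteq X$, and $f$ is one-to-one from $X$ to $X$, i.e. $\langle x,y\rangle\in f\land\langle u,y\rangle\in f\to x=u$, and $\langle x,y\rangle\in f\land y\in X\to x\in X$. *)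

(* Defs.v *)
From Stdlib Require Import List.

(** * First-order logic with membership and equality

    Terms are variables only, as de Bruijn indices. *)

Inductive form : Type :=
| fIn  (x y : nat)
| fEq  (x y : nat)
| fBot
| fAnd (p q : form)
| fOr  (p q : form)
| fImp (p q : form)
| fAll (p : form)
| fEx  (p : form).

Definition fIff (p q : form) : form := fAnd (fImp p q) (fImp q p).

Definition scons {A : Type} (a : A) (e : nat -> A) (n : nat) : A :=
  match n with 0 => a | S k => e k end.

Definition up (r : nat -> nat) : nat -> nat := scons 0 (fun n => S (r n)).

Fixpoint ren (r : nat -> nat) (p : form) : form :=
  match p with
  | fIn x y  => fIn (r x) (r y)
  | fEq x y  => fEq (r x) (r y)
  | fBot     => fBot
  | fAnd p q => fAnd (ren r p) (ren r q)
  | fOr p q  => fOr (ren r p) (ren r q)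
  | fImp p q => fImp (ren r p) (ren r q)
  | fAll p   => fAll (ren (up r) p)
  | fEx p    => fEx (ren (up r) p)
  end.

Definition shift : form -> form := ren S.

(* The variable [x] replaces index 0, and the other indices go down by one. *)
Definition inst (p : form) (x : nat) : form := ren (scons x (fun n => n)) p.

(* Intuitionistic natural deduction.  Axioms in [T] may be open: as [prv_allI]
   only restricts hypotheses, the free variables of an axiom are implicitly
   universally quantified. *)
Inductive prv (T : form -> Prop) : list form -> form -> Prop :=
| prv_ax G p : T p -> prv T G p
| prv_hyp G p : In p G -> prv T G p
| prv_botE G p : prv T G fBot -> prv T G p
| prv_andI G p q : prv T G p -> prv T G q -> prv T G (fAnd p q)
| prv_andE1 G p q : prv T G (fAnd p q) -> prv T G p
| prv_andE2 G p q : prv T G (fAnd p q) -> prv T G q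
| prv_orI1 G p q : prv T G p -> prv T G (fOr p q)
| prv_orI2 G p q : prv T G q -> prv T G (fOr p q)
| prv_orE G p q r :
    prv T G (fOr p q) -> prv T (p :: G) r -> prv T (q :: G) r -> prv T G r
| prv_impI G p q : prv T (p :: G) q -> prv T G (fImp p q)
| prv_impE G p q : prv T G (fImp p q) -> prv T G p -> prv T G q
| prv_allI G p : prv T (map shift G) p -> prv T G (fAll p)
| prv_allE G p x : prv T G (fAll p) -> prv T G (inst p x)
| prv_exI G p x : prv T G (inst p x) -> prv T G (fEx p)
| prv_exE G p q :
    prv T G (fEx p) -> prv T (p :: map shift G) (shift q) -> prv T G q
| prv_eqI G x : prv T G (fEq x x)
| prv_eqE G p x y :
    prv T G (fEq x y) -> prv T G (inst p x) -> prv T G (inst p y).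

(** * The theory INF *)

(* [e] indexes the free variables.  Each quantifier occurrence binds its own
   variable and so gets its own index. *)
Fixpoint stratified_by (e : nat -> nat) (p : form) : Prop :=
  match p with
  | fIn x y => e y = S (e x)
  | fEq x y => e x = e y
  | fBot => True
  | fAnd p q | fOr p q | fImp p q => stratified_by e p /\ stratified_by e q
  | fAll p | fEx p => exists i, stratified_by (scons i e) p
  end.

Definition stratified (p : form) : Prop := exists e, stratified_by e p.

(* In [INF_comp], index 0 of [p] is the variable of the abstract {x : p}, and
   the others are parameters; [ren (up S) p] makes room for the new set. *)
Inductive INF : form -> Prop :=
| INF_ext :
    INF (fAll (fAll (fImp (fAll (fIff (fIn 0 2) (fIn 0 1))) (fEq 1 0))))
| INF_comp p :
    stratified p -> INF (fEx (fAll (fIff (fIn 0 1) (ren (up S) p)))).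

(** * Named variables and class abstracts

    An [oform] yields a formula at each binding depth.  Variables are de Bruijn
    levels: the quantifier met at depth [d] binds level [d], which has index
    [d' - S d] at a depth [d' > d]. *)

Definition oform : Type := nat -> form.

Inductive term : Type :=
| Var (x : nat)
| Abs (P : nat -> oform).

Definition oIn (x y : nat) : oform := fun d => fIn (d - S x) (d - S y).
Definition oEq (x y : nat) : oform := fun d => fEq (d - S x) (d - S y).
Definition oAnd (p q : oform) : oform := fun d => fAnd (p d) (q d).
Definition oOr (p q : oform) : oform := fun d => fOr (p d) (q d).
Definition oImp (p q : oform) : oform := fun d => fImp (p d) (q d).
Definition oIff (p q : oform) : oform := fun d => fIff (p d) (q d).
Definition oAll (P : term -> oform) : oform := fun d => fAll (P (Var d) (S d)).
Definition oEx (P : term -> oform) : oform := fun d => fEx (P (Var d) (S d)).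
Definition set_of (P : term -> oform) : term := Abs (fun x => P (Var x)).

Definition proves (T : form -> Prop) (p : oform) : Prop := prv T nil (p 0).

(* The usual contextual elimination of abstracts: x in {y : P y} is P x,
   equality with an abstract means having the same members, and an abstract
   belongs to a class when some set equal to it does. *)
Definition var_in (x : nat) (b : term) : oform :=
  match b with Var y => oIn x y | Abs P => P x end.

Definition t_eq (a b : term) : oform :=
  match a, b with
  | Var x, Var y => oEq x y
  | _, _ =>
      fun d => fAll (oIff (var_in d a) (var_in d b) (S d))
  end.

Definition t_in (a b : term) : oform :=
  match a with
  | Var x => var_in x b
  | Abs _ => fun d => fEx (oAnd (t_eq (Var d) a) (var_in d b) (S d))
  end.

Declare Scope inf_scope.
Delimit Scope inf_scope with inf.
Bind Scope inf_scope with oform.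
Bind Scope inf_scope with term.

Notation "x ∈ y" := (t_in x y) (at level 70, no associativity) : inf_scope.
Notation "x ≐ y" := (t_eq x y) (at level 70, no associativity) : inf_scope.
Notation "p ∧ q" := (oAnd p q) (at level 80, right associativity) : inf_scope.
Notation "p ∨ q" := (oOr p q) (at level 85, right associativity) : inf_scope.
Notation "p ↔ q" := (oIff p q) (at level 95, no associativity) : inf_scope.
Notation "p → q" := (oImp p q)
  (at level 99, q at level 200, right associativity) : inf_scope.
Notation "∀ x .. y , p" := (oAll (fun x => .. (oAll (fun y => p)) ..))
  (at level 10, x binder, y binder, p at level 200) : inf_scope.
Notation "∃ x .. y , p" := (oEx (fun x => .. (oEx (fun y => p)) ..))
  (at level 10, x binder, y binder, p at level 200) : inf_scope.
Notation "⦃ x | p ⦄" := (set_of (fun x => p))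
  (at level 0, x name, p at level 200) : inf_scope.
Notation "T ⊢ p" := (proves T p%inf) (at level 100, p at level 200).

Local Open Scope inf_scope.

(** * Functions and Church numbers *)

Definition UPair (x y : term) : term := ⦃ t | t ≐ x ∨ t ≐ y ⦄.
Definition Sing (x : term) : term := ⦃ t | t ≐ x ⦄.
Definition Pair (x y : term) : term := UPair (Sing x) (UPair x y).
Notation "⟨ x , y ⟩" := (Pair x y) (at level 0) : inf_scope.

(* The double singleton puts x, y and z at the same index, as stratifying [Sum]
   requires; in a nested pair ⟨x,⟨y,z⟩⟩ or ⟨⟨x,y⟩,z⟩ they would differ. *)
Definition Triple (x y z : term) : term := ⟨ ⟨ x , y ⟩ , Sing (Sing z) ⟩.
Notation "⟨ x , y , z ⟩" := (Triple x y z) (at level 0) : inf_scope.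

Definition FUNC : term :=
  ⦃ f | ∀ x y z, ⟨ x , y ⟩ ∈ f ∧ ⟨ x , z ⟩ ∈ f → y ≐ z ⦄.

Definition Rel (f : term) : oform := ∀ p, p ∈ f → ∃ x y, p ≐ ⟨ x , y ⟩.

Definition dom (f : term) : term := ⦃ x | ∃ y, ⟨ x , y ⟩ ∈ f ⦄.

Definition Ap (f x : term) : term := ⦃ t | ∃ y, ⟨ x , y ⟩ ∈ f ∧ t ∈ y ⦄.
Notation "f · x" := (Ap f x) (at level 40, left associativity) : inf_scope.

Definition subclass (A B : term) : oform := ∀ x, x ∈ A → x ∈ B.

Definition maps (f X Y : term) : oform :=
  ∀ x, x ∈ X →
    ∃ y, (⟨ x , y ⟩ ∈ f ∧ ∀ z, ⟨ x , z ⟩ ∈ f → z ≐ y) ∧ y ∈ Y.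

Definition one_to_one (f X Y : term) : oform :=
  (∀ x u y, ⟨ x , y ⟩ ∈ f ∧ ⟨ u , y ⟩ ∈ f → x ≐ u) ∧
  (∀ x y, ⟨ x , y ⟩ ∈ f ∧ y ∈ Y → x ∈ X).

Definition injection (f X : term) : oform :=
  maps f X X ∧ Rel f ∧ f ∈ FUNC ∧ subclass (dom f) X ∧ one_to_one f X X.

Definition Id : term := ⦃ p | ∃ x, p ≐ ⟨ x , x ⟩ ∧ x ≐ x ⦄.

Definition Zero : term := ⦃ p | ∃ f, p ≐ ⟨ f , Id ⟩ ∧ f ≐ f ⦄.

Definition succ_of (z : term) : term :=
  ⦃ v | ∃ f p, v ≐ ⟨ f , p ⟩ ∧ f ∈ FUNC ∧
      ∀ u, u ∈ p ↔
        ∃ x w t q, u ≐ ⟨ x , w ⟩ ∧ t ∈ FUNC ∧ ⟨ f , t ⟩ ∈ z ∧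
          ⟨ x , q ⟩ ∈ t ∧ ⟨ q , w ⟩ ∈ f ⦄.

Definition Succ : term :=
  ⦃ v | ∃ z, v ≐ ⟨ z , succ_of z ⟩ ∧ z ∈ FUNC ⦄.

Definition Nat : term :=
  ⦃ n | ∀ X, Zero ∈ X ∧ (∀ k, k ∈ X → Succ · k ∈ X) → n ∈ X ⦄.

Definition Sum : term :=
  ⦃ v | ∀ X,
      (∀ x, x ∈ Nat → ⟨ x , Zero , x ⟩ ∈ X) ∧
      (∀ x n y, x ∈ Nat ∧ n ∈ Nat ∧ y ∈ Nat →
         ⟨ x , n , y ⟩ ∈ X → ⟨ x , Succ · n , Succ · y ⟩ ∈ X) →
      v ∈ X ⦄.

(* x ⊕ n = y; INF proves that y is unique for x, n in [Nat]. *)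
Definition plus_is (x n y : term) : oform := y ∈ Nat ∧ ⟨ x , n , y ⟩ ∈ Sum.

(* Main.v *)
From Stdlib Require Import List Arith Lia.
Require Import Defs.

(** Write [f^n] for the n-th iterate of f given by a Church number n.  By
    induction on n in [Nat], [f^n] is total on X, one-to-one, and commutes with
    f; by induction along [Sum], a + b = c gives f^a (f^b x) = f^c x.  So
    u + m = u gives f^u (f^m x) = f^u x, and f^m x = x because f^u is one-to-one.

    To argue inside INF, formulas are interpreted as upward closed sets of
    contexts, closed under the [cover] operation below, so that an interpreted
    formula holds at a context exactly when the context proves it.  Quantifiers
    and implications of the object theory thereby become those of Rocq. *)

(** * Renaming and fresh variables *)

(** Cancelling [u] inside [Nat] would call for injectivity of [Succ], so the equation is moved to
    iterates, where injectivity comes from [f]. Commutation with [f] enters because [Succ] adds an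
    outermost application, while a successor in the second summand adds one between the two
    iterates. Induction is available only for predicates that comprehension turns into sets, so the
    invariants must be stratified. A pair lies two indices above its components: with points at 0,
    [X] is at 1, [f] at 3, a Church number (a set of pairs of functions) at 6 and a triple of Church
    numbers at 10. These values recur in the calls to [stratify]. Terms are variables only, so
    [Zero], [Succ · k] or a pair is not an object until comprehension supplies a set equal to it;
    hence the many existence lemmas, and the congruence lemmas that exchange an abstract for such a
    set. *)

Lemma ren_ext r s p : (forall n, r n = s n) -> ren r p = ren s p.
Proof.
  assert (up_ext : forall r s, (forall n, r n = s n) -> forall n, up r n = up s n).
  { intros r' s' E [|n]; cbn; congruence. }
  revert r s; induction p; intros r s E; cbn; f_equal; auto.
Qed.

Lemma ren_ren r s p : ren r (ren s p) = ren (fun n => r (s n)) p.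
Proof.
  revert r s; induction p; intros r s; cbn; f_equal; auto;
    rewrite IHp; apply ren_ext; intros [|n]; reflexivity.
Qed.

Lemma ren_id r p : (forall n, r n = n) -> ren r p = p.
Proof.
  revert r; induction p; intros r E; cbn; f_equal; auto;
    apply IHp; intros [|n]; cbn; auto.
Qed.

(** Source of fresh variables: an index from [k] on is not free in a formula bounded by [k]. *)
Fixpoint bounded (k : nat) (p : form) : Prop :=
  match p with
  | fIn x y | fEq x y => x < k /\ y < k
  | fBot => True
  | fAnd p q | fOr p q | fImp p q => bounded k p /\ bounded k q
  | fAll p | fEx p => bounded (S k) p
  end.

Lemma bounded_le k l p : k <= l -> bounded k p -> bounded l p.
Proof.
  revert k l; induction p; intros k l Hl; cbn; try lia; intuition eauto.
  all: eapply IHp; [|eassumption]; lia.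
Qed.

Lemma bounded_exists p : exists k, bounded k p.
Proof.
  induction p as [x y|x y| |p [k Hk] q [l Hl]|p [k Hk] q [l Hl]|p [k Hk] q [l Hl]
                 |p [k Hk]|p [k Hk]]; cbn.
  1, 2: exists (S (x + y)); lia.
  1: exists 0; exact I.
  1, 2, 3: exists (k + l); split; eapply bounded_le; try eassumption; lia.
  all: exists k; eapply bounded_le; try eassumption; lia.
Qed.

Lemma bounded_exists_list G : exists k, forall p, In p G -> bounded k p.
Proof.
  induction G as [|q G [k Hk]]; [exists 0; easy|].
  destruct (bounded_exists q) as [l Hl].
  exists (k + l); intros p [<-|Hp]; (eapply bounded_le; [|eauto]; lia).
Qed.

Lemma ren_ext_bounded k r s p :
  bounded k p -> (forall n, n < k -> r n = s n) -> ren r p = ren s p.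
Proof.
  revert k r s; induction p; cbn; intros k r s B E; f_equal; intuition eauto.
  all: apply (IHp (S k)); auto; intros [|n] Hn; cbn; f_equal; auto with arith.
Qed.

(** * Structural rules and renaming of derivations *)

Lemma prv_weaken T G H p : incl G H -> prv T G p -> prv T H p.
Proof.
  intros I D; revert H I; induction D; intros K I.
  - now apply prv_ax.
  - apply prv_hyp; auto.
  - apply prv_botE; auto.
  - apply prv_andI; auto.
  - eapply prv_andE1; auto.
  - eapply prv_andE2; auto.
  - apply prv_orI1; auto.
  - apply prv_orI2; auto.
  - eapply prv_orE; [apply IHD1|apply IHD2|apply IHD3]; auto using incl_cons, incl_tl, in_eq.
  - apply prv_impI, IHD, incl_cons; [left; auto|now apply incl_tl].
  - eapply prv_impE; auto.
  - apply prv_allI, IHD, incl_map, I.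
  - apply prv_allE; auto.
  - eapply prv_exI; auto.
  - eapply prv_exE; [apply IHD1; auto|apply IHD2].
    apply incl_cons; [left; auto|now apply incl_tl, incl_map].
  - apply prv_eqI.
  - eapply prv_eqE; auto.
Qed.

Lemma stratified_by_ren e r p : stratified_by e (ren r p) <-> stratified_by (fun n => e (r n)) p.
Proof.
  assert (X : forall p e e', (forall n, e n = e' n) -> stratified_by e p -> stratified_by e' p).
  { clear; induction p; cbn; intros e e' E; rewrite <- ?E; intuition eauto.
    all: destruct H as [i H]; exists i; eapply IHp; [|exact H]; intros [|n]; cbn; auto. }
  revert e r; induction p; intros e r; cbn; try tauto.
  1, 2, 3: rewrite IHp1, IHp2; tauto.
  all: split; intros [i H]; exists i.
  1, 3: apply IHp in H; eapply X; [|exact H]; intros [|n]; reflexivity.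
  all: apply IHp; eapply X; [|exact H]; intros [|n]; reflexivity.
Qed.

(* A renaming that identifies variables may destroy stratification. *)
Lemma INF_ren r s p : (forall n, s (r n) = n) -> INF p -> INF (ren r p).
Proof.
  intros E [|q [e He]]; [exact INF_ext|].
  cbn. rewrite ren_ren, (ren_ext _ (fun n => up S (up r n))), <- ren_ren
    by (intros [|n]; reflexivity).
  (* The index assignment is pulled back along the left inverse [s]. *)
  apply INF_comp. exists (fun n => e (up s n)). apply stratified_by_ren.
  erewrite <- (ren_id _ q) in He; [apply stratified_by_ren, He|].
  intros [|n]; cbn; auto.
Qed.

Lemma ren_shift r p : ren (up r) (shift p) = shift (ren r p).
Proof. unfold shift; now rewrite !ren_ren. Qed.

Lemma map_ren_shift r G : map (ren (up r)) (map shift G) = map shift (map (ren r) G).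
Proof. rewrite !map_map; apply map_ext, ren_shift. Qed.

Lemma ren_inst r p x : ren r (inst p x) = inst (ren (up r) p) (r x).
Proof. unfold inst; rewrite !ren_ren; apply ren_ext; intros [|n]; reflexivity. Qed.

(** The left inverse [b] is carried for the axiom case; it passes under binders because [up b]
    inverts [up a]. *)
Lemma prv_ren a b G p :
  (forall n, b (a n) = n) -> prv INF G p -> prv INF (map (ren a) G) (ren a p).
Proof.
  intros E D; revert a b E; induction D; intros a b E; cbn.
  - eapply prv_ax, INF_ren; eauto.
  - apply prv_hyp, in_map; auto.
  - apply prv_botE; eauto.
  - apply prv_andI; eauto.
  - eapply prv_andE1; apply (IHD a b E).
  - eapply prv_andE2; apply (IHD a b E).
  - apply prv_orI1; eauto.
  - apply prv_orI2; eauto.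
  - eapply prv_orE; [apply (IHD1 a b E)|apply (IHD2 a b E)|apply (IHD3 a b E)].
  - apply prv_impI; apply (IHD a b E).
  - eapply prv_impE; [apply (IHD1 a b E)|eauto].
  - apply prv_allI; rewrite <- map_ren_shift; apply (IHD (up a) (up b)).
    intros [|n]; cbn; auto.
  - rewrite ren_inst; apply prv_allE, (IHD a b E).
  - eapply prv_exI; rewrite <- ren_inst; eauto.
  - eapply prv_exE; [apply (IHD1 a b E)|].
    rewrite <- map_ren_shift, <- ren_shift; apply (IHD2 (up a) (up b)).
    intros [|n]; cbn; auto.
  - apply prv_eqI.
  - rewrite ren_inst; eapply prv_eqE; [apply (IHD1 a b E)|].
    rewrite <- ren_inst; eauto.
Qed.

(** An instance at a variable fresh for [G] and [p] is already generic. This lets a universal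
    quantifier be read as Rocq quantification over variables. *)
Lemma prv_open G p : (forall n, prv INF G (inst p n)) -> prv INF (map shift G) p.
Proof.
  intros H. destruct (bounded_exists_list (fAll p :: G)) as [k Hk].
  (* [r] sends the fresh [k] to the bound variable 0 and shifts the rest; [scons k (fun n => n)]
     undoes it, so [prv_ren] applies. *)
  set (r n := if n =? k then 0 else S n).
  replace (map shift G) with (map (ren r) G).
  - replace p with (ren r (inst p k)).
    + apply prv_ren with (scons k (fun n => n)); auto.
      intros n; unfold r; destruct (Nat.eqb_spec n k); cbn; congruence.
    + unfold inst; rewrite ren_ren.
      etransitivity; [|apply (ren_id (fun n => n)); reflexivity].
      apply (ren_ext_bounded (S k)); [apply (Hk (fAll p)); cbn; auto|].
      intros [|n] Hn; cbn; unfold r; [now rewrite Nat.eqb_refl|].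
      destruct (Nat.eqb_spec n k); lia.
  - apply map_ext_in; intros q Hq; apply (ren_ext_bounded k); [apply Hk; cbn; auto|].
    intros n Hn; unfold r; destruct (Nat.eqb_spec n k); lia.
Qed.

Lemma inst_shift p n : inst (shift p) n = p.
Proof. unfold inst, shift; rewrite ren_ren; now apply ren_id. Qed.

Lemma prv_exE_inst G p q :
  prv INF G (fEx p) -> (forall n, prv INF (inst p n :: G) q) -> prv INF G q.
Proof.
  intros D H. eapply prv_exE; [exact D|].
  (* The witness hypothesis moves into the conclusion as an implication, since [prv_open] allows
     only shifted formulas in the context. *)
  eapply prv_impE; [|apply prv_hyp, in_eq].
  apply (prv_weaken _ (map shift G)); [apply incl_tl, incl_refl|].
  apply prv_open; intros n; cbn.
  fold (inst p n) (inst (shift q) n); rewrite inst_shift; apply prv_impI, H.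
Qed.

Lemma inst_ren e p n : inst (ren (up e) p) n = ren (scons n e) p.
Proof. unfold inst; rewrite ren_ren; apply ren_ext; intros [|m]; reflexivity. Qed.

(** Unlike [prv_ren], this covers renamings that identify variables: without hypotheses, each free
    variable can be generalized and then instantiated at will. Comprehension relies on it, as its
    parameters may coincide. *)
Lemma prv_closed_ren e p : prv INF nil p -> prv INF nil (ren e p).
Proof.
  destruct (bounded_exists p) as [k B].
  revert p e B; induction k; intros p e B D.
  - rewrite (ren_ext_bounded 0 e (fun n => n)), ren_id; auto; lia.
  - apply (prv_allI _ nil), (IHk (fAll p) (fun n => e (S n)) B) in D; cbn in D.
    apply (prv_allE _ _ _ (e 0)) in D; rewrite inst_ren in D.
    erewrite ren_ext; [exact D|]; intros [|n]; reflexivity.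
Qed.

(** * Kripke-style semantics over contexts *)

(* [cover A] is the closure of [A] in the MacNeille completion of the
   Lindenbaum algebra; it is what makes disjunctions and existentials, which
   need not have witnesses, agree with provability. *)
Definition cover (A : list form -> Prop) (w : list form) : Prop :=
  forall v C, incl w v -> (forall u, incl v u -> A u -> prv INF u C) -> prv INF v C.

Record wprop : Type := WProp {
  holds : list form -> Prop;
  holds_mono w v : incl w v -> holds w -> holds v;
  holds_cover w : cover holds w -> holds w }.

Notation "w ⊩ A" := (holds A w) (at level 70, A at level 69).

Lemma cover_mono A w v : incl w v -> cover A w -> cover A v.
Proof. intros L H u C M; apply H; eapply incl_tran; eauto. Qed.

Lemma cover_cover A w : cover (cover A) w -> cover A w.
Proof.
  intros H v C L K; apply (H v C L); intros u M J.
  apply (J u C (incl_refl u)); intros t N; apply K; eapply incl_tran; eauto.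
Qed.

Lemma cover_map (A B : list form -> Prop) w v :
  incl w v -> (forall u, incl v u -> A u -> B u) -> cover A w -> cover B v.
Proof.
  intros L H J u C M K; apply (J u C); [eapply incl_tran; eauto|].
  intros t N a; apply (K t N), H; [eapply incl_tran; eauto|exact a].
Qed.

Definition wCover (A : list form -> Prop) : wprop :=
  WProp (cover A) (cover_mono A) (cover_cover A).

Lemma atom_cover p w : cover (fun w => prv INF w p) w -> prv INF w p.
Proof. intros H; apply (H w p (incl_refl w)); auto. Qed.

Definition wAtom (p : form) : wprop :=
  WProp (fun w => prv INF w p)
    (fun w v L => prv_weaken INF w v p L) (atom_cover p).

Program Definition wAnd (A B : wprop) : wprop :=
  WProp (fun w => w ⊩ A /\ w ⊩ B) _ _.
Next Obligation. split; eapply holds_mono; eauto. Qed.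
Next Obligation.
  split; apply holds_cover; (eapply cover_map; [apply incl_refl| |exact H]); now intros u _ [].
Qed.

Program Definition wImp (A B : wprop) : wprop :=
  WProp (fun w => forall v, incl w v -> v ⊩ A -> v ⊩ B) _ _.
Next Obligation. apply H0; auto; eapply incl_tran; eauto. Qed.
Next Obligation.
  apply holds_cover; (eapply cover_map; [exact H0| |exact H]).
  intros u M K; apply (K u (incl_refl u)); eapply holds_mono; eauto.
Qed.

Program Definition wAll (P : nat -> wprop) : wprop :=
  WProp (fun w => forall n, w ⊩ P n) _ _.
Next Obligation. eapply holds_mono; eauto. Qed.
Next Obligation.
  apply holds_cover; (eapply cover_map; [apply incl_refl| |exact H]); auto.
Qed.

Definition wOr (A B : wprop) : wprop := wCover (fun w => w ⊩ A \/ w ⊩ B).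
Definition wEx (P : nat -> wprop) : wprop := wCover (fun w => exists n, w ⊩ P n).
Definition wIff (A B : wprop) : wprop := wAnd (wImp A B) (wImp B A).
Definition wIn (x y : nat) : wprop := wAtom (fIn x y).
Definition wEq (x y : nat) : wprop := wAtom (fEq x y).

Fixpoint sem (e : nat -> nat) (p : form) : wprop :=
  match p with
  | fIn x y => wIn (e x) (e y)
  | fEq x y => wEq (e x) (e y)
  | fBot => wAtom fBot
  | fAnd p q => wAnd (sem e p) (sem e q)
  | fOr p q => wOr (sem e p) (sem e q)
  | fImp p q => wImp (sem e p) (sem e q)
  | fAll p => wAll (fun n => sem (scons n e) p)
  | fEx p => wEx (fun n => sem (scons n e) p)
  end.

(** The universal case rests on [prv_open]. For disjunctions and existentials, [cover] quantifies
    over all conclusions [C]: taking the formula itself as [C] gives provability, and the converse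
    is the elimination rule. *)
Lemma sem_prv e p w : w ⊩ sem e p <-> prv INF w (ren e p).
Proof.
  revert e w; induction p as [x y|x y| |p IHp q IHq|p IHp q IHq|p IHp q IHq|p IHp|p IHp];
    intros e w; cbn [sem ren]; try reflexivity.
  - cbn; rewrite IHp, IHq; split; [intros [H K]; now apply prv_andI|].
    intros H; split; [eapply prv_andE1|eapply prv_andE2]; eauto.
  - split.
    + intros H; apply (H w _ (incl_refl w)); intros v L [K|K].
      * now apply prv_orI1, IHp.
      * now apply prv_orI2, IHq.
    + intros H v C L K; eapply prv_orE; [apply prv_weaken with w; eauto| |].
      * apply K; [apply incl_tl, incl_refl|]; left; apply IHp, prv_hyp, in_eq.
      * apply K; [apply incl_tl, incl_refl|]; right; apply IHq, prv_hyp, in_eq.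
  - split.
    + intros H; apply prv_impI, IHq, H; [apply incl_tl, incl_refl|].
      apply IHp, prv_hyp, in_eq.
    + intros H v L K; apply IHq; eapply prv_impE; [apply prv_weaken with w; eauto|].
      now apply IHp.
  - split.
    + intros H; apply prv_allI; apply prv_open; intros n; rewrite inst_ren; apply IHp, H.
    + intros H n; apply IHp; rewrite <- inst_ren; now apply prv_allE.
  - split.
    + intros H; apply (H w _ (incl_refl w)); intros v L [n K].
      apply prv_exI with n; rewrite inst_ren; now apply IHp.
    + intros H v C L K; eapply prv_exE_inst; [apply prv_weaken with w; eauto|].
      intros n; apply K; [apply incl_tl, incl_refl|]; exists n; apply IHp.
      rewrite <- inst_ren; apply prv_hyp, in_eq.
Qed.

(** * Equality, extensionality and comprehension at a context *)

Lemma wEq_refl w x : w ⊩ wEq x x.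
Proof. apply prv_eqI. Qed.

Lemma wEq_sym w x y : w ⊩ wEq x y -> w ⊩ wEq y x.
Proof.
  intros E; apply (prv_eqE INF w (fEq 0 (S x)) x y E), prv_eqI.
Qed.

Lemma wEq_trans w x y z : w ⊩ wEq x y -> w ⊩ wEq y z -> w ⊩ wEq x z.
Proof. intros E F; apply (prv_eqE INF w (fEq (S x) 0) y z F), E. Qed.

Lemma wIn_congr w x y x' y' :
  w ⊩ wEq x x' -> w ⊩ wEq y y' -> w ⊩ wIn x y -> w ⊩ wIn x' y'.
Proof.
  intros E F H; apply (prv_eqE INF w (fIn (S x') 0) y y' F).
  apply (prv_eqE INF w (fIn 0 (S y)) x x' E), H.
Qed.

Lemma sem_congr w e e' p :
  (forall i, w ⊩ wEq (e i) (e' i)) -> w ⊩ sem e p -> w ⊩ sem e' p.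
Proof.
  revert w e e'; induction p as [x y|x y| |p IHp q IHq|p IHp q IHq|p IHp q IHq|p IHp|p IHp];
    intros w e e' E; cbn [sem]; auto.
  - apply wIn_congr; apply E.
  - intros H; eapply wEq_trans; [apply wEq_sym, E|]; eapply wEq_trans; [exact H|apply E].
  - intros [H K]; split; eauto.
  - apply cover_map; [apply incl_refl|]; intros v L.
    assert (forall i, v ⊩ wEq (e i) (e' i)) by (intros i; eapply holds_mono; eauto).
    intros [H1|H1]; eauto.
  - intros H v L K.
    assert (forall i, v ⊩ wEq (e i) (e' i)) by (intros i; eapply holds_mono; eauto).
    apply IHq with e; auto; apply H; auto.
    apply IHp with e'; auto; intros i; apply wEq_sym; auto.
  - intros H n; eapply IHp; [|apply H]; intros [|i]; [apply wEq_refl|apply E].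
  - apply cover_map; [apply incl_refl|]; intros v L [n H]; exists n.
    eapply IHp; [|exact H]; intros [|i]; [apply wEq_refl|eapply holds_mono; eauto].
Qed.

Lemma wEq_ext w x y : w ⊩ wAll (fun z => wIff (wIn z x) (wIn z y)) -> w ⊩ wEq x y.
Proof.
  intros H.
  assert (D : w ⊩ sem (fun n => n)
                (fAll (fAll (fImp (fAll (fIff (fIn 0 2) (fIn 0 1))) (fEq 1 0))))).
  { apply sem_prv, prv_ax, INF_ext. }
  exact (D x y w (incl_refl w) H).
Qed.

Lemma comprehension_sem w e p :
  stratified p ->
  w ⊩ wEx (fun a => wAll (fun x => wIff (wIn x a) (sem (scons x e) p))).
Proof.
  intros St.
  pose proof (prv_closed_ren e _ (prv_ax INF nil _ (INF_comp p St))) as D.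
  apply sem_prv, holds_mono with (v := w) in D; [|easy].
  revert D; apply cover_map; [apply incl_refl|]; intros v L [a H]; exists a; intros x.
  (* [up S] skips the new set [a], so [a] drops out of the environment. *)
  assert (E : forall v, v ⊩ sem (scons x (scons a e)) (ren (up S) p)
                        <-> v ⊩ sem (scons x e) p).
  { intros u; rewrite !sem_prv, ren_ren; erewrite ren_ext; [reflexivity|].
    intros [|n]; reflexivity. }
  split; intros u M K; [apply E|]; apply (H x); auto; apply E, K.
Qed.

Lemma wEx_i P n w : w ⊩ P n -> w ⊩ wEx P.
Proof. intros H v C L K; apply (K v (incl_refl v)); exists n; eapply holds_mono; eauto. Qed.

Lemma wEx_e P C w :
  w ⊩ wEx P -> (forall v n, incl w v -> v ⊩ P n -> v ⊩ C) -> w ⊩ C.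
Proof.
  intros H K; apply holds_cover; revert H; apply cover_map; [apply incl_refl|].
  intros v L [n H]; eauto.
Qed.

Lemma wOr_l A B w : w ⊩ A -> w ⊩ wOr A B.
Proof. intros H v C L K; apply (K v (incl_refl v)); left; eapply holds_mono; eauto. Qed.

Lemma wOr_r A B w : w ⊩ B -> w ⊩ wOr A B.
Proof. intros H v C L K; apply (K v (incl_refl v)); right; eapply holds_mono; eauto. Qed.

Lemma wOr_e A B C w :
  w ⊩ wOr A B -> (forall v, incl w v -> v ⊩ A -> v ⊩ C) ->
  (forall v, incl w v -> v ⊩ B -> v ⊩ C) -> w ⊩ C.
Proof.
  intros H K M; apply holds_cover; revert H; apply cover_map; [apply incl_refl|].
  intros v L [H|H]; eauto.
Qed.

Lemma wImp_e A B w : w ⊩ wImp A B -> w ⊩ A -> w ⊩ B.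
Proof. intros H; apply H, incl_refl. Qed.

Lemma wIff_1 A B w : w ⊩ wIff A B -> w ⊩ A -> w ⊩ B.
Proof. intros [H _]; now apply wImp_e. Qed.

Lemma wIff_2 A B w : w ⊩ wIff A B -> w ⊩ B -> w ⊩ A.
Proof. intros [_ H]; now apply wImp_e. Qed.

(** Transports every hypothesis from [w] to the larger context [v] and renames [v] to [w], so that a
    proof appears to stay at one context. *)
Ltac lift :=
  match goal with
  | L : incl ?w ?v |- _ =>
      repeat match goal with H : holds ?A w |- _ => apply (holds_mono A w v L) in H end;
      clear L; clear w; rename v into w
  end.

Tactic Notation "wintro" simple_intropattern(p) :=
  let H := fresh in
  intros ? ? H; lift; revert H; intros p.

Tactic Notation "wex" constr(H) "as" ident(x) simple_intropattern(p) :=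
  let K := fresh in
  apply (wEx_e _ _ _ H); try clear H; intros ? x ? K; lift; revert K; intros p.

Tactic Notation "wor" constr(H) "as" simple_intropattern(p) :=
  let K := fresh in
  apply (wOr_e _ _ _ _ H); try clear H; intros ? ? K; lift; revert K; intros p.

(** * Class abstracts *)

(* A class abstract [Abs P] is represented by the predicate "is equal to Abs P"
   on variables, [wIs A] for [A] the meaning of [P]; a variable by [eqv]. *)
Definition wIs (A : nat -> wprop) (s : nat) : wprop :=
  wAll (fun t => wIff (wIn t s) (A t)).
Definition eqv (x : nat) : nat -> wprop := fun s => wEq s x.
Definition isUPair (A B : nat -> wprop) : nat -> wprop := wIs (fun s => wOr (A s) (B s)).
Definition isPair (A B : nat -> wprop) : nat -> wprop := isUPair (wIs A) (isUPair A B).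
Definition wPair (x y v : nat) : wprop := isPair (eqv x) (eqv y) v.
Definition wPairIn (x y f : nat) : wprop := wEx (fun v => wAnd (wPair x y v) (wIn v f)).

Definition sameclass (A B : nat -> wprop) : wprop := wAll (fun t => wIff (A t) (B t)).

Lemma wIs_unique w A s t : w ⊩ wIs A s -> w ⊩ wIs A t -> w ⊩ wEq s t.
Proof.
  intros H K; apply wEq_ext; intros z; split; wintro M.
  - eapply wIff_2; [apply K|]; eapply wIff_1; [apply H|exact M].
  - eapply wIff_2; [apply H|]; eapply wIff_1; [apply K|exact M].
Qed.

Lemma wIs_congr w A B : w ⊩ sameclass A B -> w ⊩ sameclass (wIs A) (wIs B).
Proof.
  intros H s; split; wintro K; intros t; split; wintro M.
  - eapply wIff_1; [apply H|]; eapply wIff_1; [apply K|exact M].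
  - eapply wIff_2; [apply K|]; eapply wIff_2; [apply H|exact M].
  - eapply wIff_2; [apply H|]; eapply wIff_1; [apply K|exact M].
  - eapply wIff_2; [apply K|]; eapply wIff_1; [apply H|exact M].
Qed.

Lemma isUPair_congr w A A' B B' :
  w ⊩ sameclass A A' -> w ⊩ sameclass B B' -> w ⊩ sameclass (isUPair A B) (isUPair A' B').
Proof.
  intros H K; apply wIs_congr; intros t; split; wintro M; wor M as M.
  - apply wOr_l; eapply wIff_1; [apply H|exact M].
  - apply wOr_r; eapply wIff_1; [apply K|exact M].
  - apply wOr_l; eapply wIff_2; [apply H|exact M].
  - apply wOr_r; eapply wIff_2; [apply K|exact M].
Qed.

Lemma isPair_congr w A A' B B' :
  w ⊩ sameclass A A' -> w ⊩ sameclass B B' -> w ⊩ sameclass (isPair A B) (isPair A' B').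
Proof. intros; apply isUPair_congr; [apply wIs_congr|apply isUPair_congr]; auto. Qed.

Lemma sameclass_refl w A : w ⊩ sameclass A A.
Proof. intros t; split; wintro ?; auto. Qed.

(** Lets a set stand in for an abstract: through the congruence lemmas, pairs with abstract
    components become pairs of variables. *)
Lemma sameclass_eqv w A s : w ⊩ wIs A s -> w ⊩ sameclass (eqv s) (wIs A).
Proof.
  intros H t; split; wintro K.
  - intros z; split; wintro M.
    + eapply wIff_1; [apply H|]; eapply wIn_congr; [apply wEq_refl|apply K|exact M].
    + eapply wIn_congr; [apply wEq_refl|apply wEq_sym, K|].
      eapply wIff_2; [apply H|exact M].
  - eapply wIs_unique; eauto.
Qed.

(* [sem e f] and the intended [A] are often convertible, but [fIff] copies its
   arguments, so comparing them by conversion is exponential in the nesting of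
   biconditionals; the rules below visit each one once. *)
Definition den (e : nat -> nat) (f : form) (A : wprop) : Prop :=
  forall w, w ⊩ sem e f <-> w ⊩ A.

Lemma den_and e d p q A B :
  den e (p d) A -> den e (q d) B -> den e (oAnd p q d) (wAnd A B).
Proof. intros H K w; cbn; now rewrite (H w), (K w). Qed.

Lemma den_or e d p q A B :
  den e (p d) A -> den e (q d) B -> den e (oOr p q d) (wOr A B).
Proof.
  intros H K w; split; apply cover_map; auto using incl_refl; intros v _ [M|M].
  1, 3: left; now apply H.
  all: right; now apply K.
Qed.

Lemma den_imp e d p q A B :
  den e (p d) A -> den e (q d) B -> den e (oImp p q d) (wImp A B).
Proof. intros H K w; split; intros M v L N; apply K, M; auto; now apply H. Qed.

Lemma den_iff e d p q A B :
  den e (p d) A -> den e (q d) B -> den e (oIff p q d) (wIff A B).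
Proof.
  intros H K; apply (den_and _ _ (oImp p q) (oImp q p)); now apply den_imp.
Qed.

Lemma den_all e d P A :
  (forall n, den (scons n e) (P (Var d) (S d)) (A n)) -> den e (oAll P d) (wAll A).
Proof. intros H w; split; intros M n; apply H, M. Qed.

Lemma den_ex e d P A :
  (forall n, den (scons n e) (P (Var d) (S d)) (A n)) -> den e (oEx P d) (wEx A).
Proof.
  intros H w; split; apply cover_map; auto using incl_refl; intros v _ [n M];
    exists n; now apply H.
Qed.

Lemma den_in_abs e d P b A B :
  (forall n, den (scons n e) (t_eq (Var d) (Abs P) (S d)) (A n)) ->
  (forall n, den (scons n e) (t_in (Var d) b (S d)) (B n)) ->
  den e (t_in (Abs P) b d) (wEx (fun n => wAnd (A n) (B n))).
Proof.
  intros H K; apply (den_ex _ _ (fun _ => oAnd (t_eq (Var d) (Abs P)) (t_in (Var d) b))).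
  intros n; now apply den_and.
Qed.

Lemma den_is e d x P A s :
  (forall n, den (scons n e) (P d (S d)) (A n)) ->
  (forall n, den (scons n e) (oIn d x (S d)) (wIn n s)) ->
  den e (t_eq (Var x) (Abs P) d) (wIs A s).
Proof.
  intros H K; apply (den_all _ _ (fun _ => oIff (oIn d x) (P d))).
  intros n; now apply den_iff.
Qed.

Lemma den_is_r e d x P A s :
  (forall n, den (scons n e) (P d (S d)) (A n)) ->
  (forall n, den (scons n e) (oIn d x (S d)) (wIn n s)) ->
  den e (t_eq (Abs P) (Var x) d) (wAll (fun t => wIff (A t) (wIn t s))).
Proof.
  intros H K; apply (den_all _ _ (fun _ => oIff (P d) (oIn d x))).
  intros n; now apply den_iff.
Qed.

Ltac head t := lazymatch t with ?f _ => head f | _ => t end.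

Ltac denote :=
  lazy beta;
  lazymatch goal with
  | |- forall _, _ => intro; denote
  | |- den _ (oAnd _ _ _) _ => apply den_and; denote
  | |- den _ (oOr _ _ _) _ => apply den_or; denote
  | |- den _ (oImp _ _ _) _ => apply den_imp; denote
  | |- den _ (oIff _ _ _) _ => apply den_iff; denote
  | |- den _ (oAll _ _) _ => apply den_all; denote
  | |- den _ (oEx _ _) _ => apply den_ex; denote
  | |- den _ (t_in (Var _) (Var _) _) _ => intro; reflexivity
  | |- den _ (t_eq (Var _) (Var _) _) _ => intro; reflexivity
  | |- den _ (oIn _ _ _) _ => intro; reflexivity
  | |- den ?e (t_in (Var ?x) (Abs ?P) ?d) ?A => change (den e (P x d) A); denote
  | |- den _ (t_in (Abs _) _ _) _ => apply den_in_abs; denote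
  | |- den _ (t_eq (Var _) (Abs _) _) _ => apply den_is; denote
  | |- den _ (t_eq (Abs _) (Var _) _) _ => apply den_is_r; denote
  | |- den ?e (t_in (Var ?x) ?b ?d) ?A =>
      let b' := eval hnf in b in change (den e (t_in (Var x) b' d) A); denote
  | |- den ?e (t_in ?b ?c ?d) ?A =>
      let b' := eval hnf in b in change (den e (t_in b' c d) A); denote
  | |- den ?e (t_eq (Var ?x) ?b ?d) ?A =>
      let b' := eval hnf in b in change (den e (t_eq (Var x) b' d) A); denote
  | |- den ?e (t_eq ?b ?c ?d) ?A =>
      let b' := eval hnf in b in change (den e (t_eq b' c d) A); denote
  | |- den ?e (?p ?d) ?A =>
      let h := head p in
      let p' := eval unfold h in p in change (den e (p' d) A); denote
  end.

(** An interpreted predicate respects equality as soon as a formula denoting it is exhibited. *)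
Lemma den_congr w e e' p A A' :
  den e p A -> den e' p A' -> (forall i, w ⊩ wEq (e i) (e' i)) -> w ⊩ A -> w ⊩ A'.
Proof. intros H K E M; apply K, (sem_congr w e e'), H; auto. Qed.

Lemma comprehension w e p P :
  stratified p -> (forall x, den (scons x e) p (P x)) ->
  w ⊩ wEx (fun a => wAll (fun x => wIff (wIn x a) (P x))).
Proof.
  intros St H. generalize (comprehension_sem w e p St).
  apply cover_map; [apply incl_refl|]; intros v _ [a K]; exists a; intros x.
  split; intros u L M.
  - apply H. exact (proj1 (K x) u L M).
  - apply (proj2 (K x) u L). now apply H.
Qed.

(* [e] gives the indices of the free variables, the element variable of the
   abstract first; unification finds those of the bound variables. *)
Ltac stratify e :=
  exists e; cbn; repeat first [reflexivity | exact I | split | eexists].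

Local Notation id := (fun n => n).

Lemma pair_exists w x y : w ⊩ wEx (wPair x y).
Proof.
  (* Levels run opposite to indices: at depth 3, [Var 0] has index 2 and [Var 2], the element, has
     index 0. Hence [x] comes after [y] in the environment. *)
  apply (comprehension w (scons y (scons x id)) (t_in (Var 2) (Pair (Var 0) (Var 1)) 3)).
  - stratify (scons 1 (scons 0 (fun _ => 0))).
  - denote.
Qed.
Lemma sing_exists w x : w ⊩ wEx (wIs (eqv x)).
Proof.
  apply (comprehension w (scons x id) (t_in (Var 1) (Sing (Var 0)) 2)).
  - stratify (fun _ : nat => 0).
  - denote.
Qed.

(** * Ordered pairs *)

Lemma upair_exists w x y : w ⊩ wEx (isUPair (eqv x) (eqv y)).
Proof.
  apply (comprehension w (scons y (scons x id)) (t_in (Var 2) (UPair (Var 0) (Var 1)) 3)).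
  - stratify (fun _ : nat => 0).
  - denote.
Qed.

Ltac weq := eauto 4 using wEq_refl, wEq_sym, wEq_trans.

Lemma sing_mem w x s t : w ⊩ wIs (eqv x) s -> w ⊩ wIn t s -> w ⊩ wEq t x.
Proof. intros H K; exact (wIff_1 _ _ _ (H t) K). Qed.

Lemma sing_self w x s : w ⊩ wIs (eqv x) s -> w ⊩ wIn x s.
Proof. intros H; apply (wIff_2 _ _ _ (H x)), wEq_refl. Qed.

Lemma upair_mem w x y s t :
  w ⊩ isUPair (eqv x) (eqv y) s -> w ⊩ wIn t s -> w ⊩ wOr (wEq t x) (wEq t y).
Proof. intros H K; exact (wIff_1 _ _ _ (H t) K). Qed.

Lemma upair_left w x y s : w ⊩ isUPair (eqv x) (eqv y) s -> w ⊩ wIn x s.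
Proof. intros H; apply (wIff_2 _ _ _ (H x)), wOr_l, wEq_refl. Qed.

Lemma upair_right w x y s : w ⊩ isUPair (eqv x) (eqv y) s -> w ⊩ wIn y s.
Proof. intros H; apply (wIff_2 _ _ _ (H y)), wOr_r, wEq_refl. Qed.

Lemma pair_fst w x y x' y' v : w ⊩ wPair x y v -> w ⊩ wPair x' y' v -> w ⊩ wEq x x'.
Proof.
  intros H K; wex (sing_exists w x) as s Hs.
  assert (M : w ⊩ wOr (wIs (eqv x') s) (isUPair (eqv x') (eqv y') s)).
  { apply (wIff_1 _ _ _ (K s)), (wIff_2 _ _ _ (H s)), wOr_l, Hs. }
  wor M as M.
  - eapply sing_mem, sing_self; eauto.
  - eapply wEq_sym, sing_mem, upair_left; eauto.
Qed.

(** Equality is not decidable here, so the cases do not ask whether [x] and [y] agree; they ask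
    which member of the other pair each of {x,y} and {x',y'} equals. *)
Lemma pair_snd w x y x' y' v : w ⊩ wPair x y v -> w ⊩ wPair x' y' v -> w ⊩ wEq y y'.
Proof.
  intros H K; pose proof (pair_fst _ _ _ _ _ _ H K) as E.
  wex (upair_exists w x y) as s Hs; wex (upair_exists w x' y') as t Ht.
  assert (M : w ⊩ wOr (wIs (eqv x') s) (isUPair (eqv x') (eqv y') s)).
  { apply (wIff_1 _ _ _ (K s)), (wIff_2 _ _ _ (H s)), wOr_r, Hs. }
  assert (N : w ⊩ wOr (wIs (eqv x) t) (isUPair (eqv x) (eqv y) t)).
  { apply (wIff_1 _ _ _ (H t)), (wIff_2 _ _ _ (K t)), wOr_r, Ht. }
  wor M as H0.
  - pose proof (sing_mem _ _ _ _ H0 (upair_right _ _ _ _ Hs)) as F.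
    wor N as H1.
    + pose proof (sing_mem _ _ _ _ H1 (upair_right _ _ _ _ Ht)) as G; weq.
    + pose proof (upair_mem _ _ _ _ _ H1 (upair_right _ _ _ _ Ht)) as G; wor G as G'; weq.
  - pose proof (upair_mem _ _ _ _ _ H0 (upair_right _ _ _ _ Hs)) as F.
    wor F as F'; [|weq].
    pose proof (upair_mem _ _ _ _ _ Hs (upair_right _ _ _ _ H0)) as G; wor G as G'; weq.
Qed.

Lemma pair_unique w x y v v' : w ⊩ wPair x y v -> w ⊩ wPair x y v' -> w ⊩ wEq v v'.
Proof. apply wIs_unique. Qed.

Lemma sameclass_eq w x x' : w ⊩ wEq x x' -> w ⊩ sameclass (eqv x) (eqv x').
Proof. intros E t; split; wintro H; unfold eqv in *; weq. Qed.

Lemma pair_congr w x y x' y' v :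
  w ⊩ wEq x x' -> w ⊩ wEq y y' -> w ⊩ wPair x y v -> w ⊩ wPair x' y' v.
Proof. intros E F; eapply wIff_1, isPair_congr; apply sameclass_eq; auto. Qed.

Lemma pairIn_i w x y v f : w ⊩ wPair x y v -> w ⊩ wIn v f -> w ⊩ wPairIn x y f.
Proof. intros H K; apply wEx_i with v; now split. Qed.

Lemma pairIn_e w x y v f : w ⊩ wPair x y v -> w ⊩ wPairIn x y f -> w ⊩ wIn v f.
Proof.
  intros H K; wex K as v' [K M].
  eapply wIn_congr; [eapply pair_unique; eauto|apply wEq_refl|exact M].
Qed.

Lemma pairIn_congr w x y f x' y' f' :
  w ⊩ wEq x x' -> w ⊩ wEq y y' -> w ⊩ wEq f f' -> w ⊩ wPairIn x y f -> w ⊩ wPairIn x' y' f'.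
Proof.
  intros E F G H; wex H as v [H K].
  apply pairIn_i with v; [eapply pair_congr; eauto|].
  eapply wIn_congr; [apply wEq_refl| |]; eauto.
Qed.

Lemma pairIn_is w (P : nat -> nat -> wprop) x y f :
  w ⊩ wIs (fun v => wEx (fun x => wEx (fun y => wAnd (wPair x y v) (P x y)))) f ->
  (forall v x' y', v ⊩ wEq x' x -> v ⊩ wEq y' y -> v ⊩ P x' y' -> v ⊩ P x y) ->
  w ⊩ wIff (wPairIn x y f) (P x y).
Proof.
  intros H C; split; wintro K.
  - wex K as v [K M]. pose proof (wIff_1 _ _ _ (H v) M) as N; cbn beta in N.
    wex N as x' N; wex N as y' [N O].
    apply C with x' y'; [| |exact O].
    + exact (pair_fst _ _ _ _ _ _ N K).
    + exact (pair_snd _ _ _ _ _ _ N K).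
  - wex (pair_exists w x y) as p Hp.
    apply pairIn_i with p; auto. apply (wIff_2 _ _ _ (H p)).
    apply wEx_i with x, wEx_i with y; split; auto.
Qed.

(** * Church numbers *)

Definition wFunc (f : nat) : wprop :=
  wAll (fun x => wAll (fun y => wAll (fun z =>
    wImp (wAnd (wPairIn x y f) (wPairIn x z f)) (wEq y z)))).

Lemma func_unique w f x y z :
  w ⊩ wFunc f -> w ⊩ wPairIn x y f -> w ⊩ wPairIn x z f -> w ⊩ wEq y z.
Proof. intros H K M; apply (H x y z w (incl_refl w)); now split. Qed.

Definition wIsId : nat -> wprop :=
  wIs (fun p => wEx (fun x => wAnd (wPair x x p) (wEq x x))).

Definition wIsZero : nat -> wprop :=
  wIs (fun p => wEx (fun f => wAnd (isPair (eqv f) wIsId p) (wEq f f))).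

Lemma id_exists w : w ⊩ wEx wIsId.
Proof.
  apply (comprehension w id (t_in (Var 0) Id 1)).
  - stratify (fun _ : nat => 2).
  - denote.
Qed.

Lemma zero_exists w : w ⊩ wEx wIsZero.
Proof.
  apply (comprehension w id (t_in (Var 0) Zero 1)).
  (* Members of [Id] are at least at 2, so [Id] and [f] are at 3 and their pair at 5. *)
  - stratify (fun _ : nat => 5).
  - denote.
Qed.

Lemma id_pair w i x y : w ⊩ wIsId i -> w ⊩ wIff (wPairIn x y i) (wEq x y).
Proof.
  intros H; split; wintro K.
  - wex K as v [K M]. pose proof (wIff_1 _ _ _ (H v) M) as N; cbn beta in N.
    wex N as z [N _].
    eapply wEq_trans; [exact (pair_fst _ _ _ _ _ _ K N)|].
    exact (wEq_sym _ _ _ (pair_snd _ _ _ _ _ _ K N)).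
  - wex (pair_exists w x y) as p Hp. apply pairIn_i with p; auto.
    apply (wIff_2 _ _ _ (H p)), wEx_i with x; split; [|apply wEq_refl].
    exact (pair_congr _ _ _ _ _ _ (wEq_refl _ _) (wEq_sym _ _ _ K) Hp).
Qed.

Lemma id_func w i : w ⊩ wIsId i -> w ⊩ wFunc i.
Proof.
  intros H x y z; wintro [K M].
  apply (wIff_1 _ _ _ (id_pair w i _ _ H)) in K, M; weq.
Qed.

Lemma zero_pair w z f g : w ⊩ wIsZero z -> w ⊩ wIff (wPairIn f g z) (wIsId g).
Proof.
  intros H; split; wintro K.
  - wex K as v [K M]. pose proof (wIff_1 _ _ _ (H v) M) as N; cbn beta in N.
    (* A set [i] replaces the abstract [Id] inside the pair, so that injectivity of pairs
       applies. *)
    wex N as f' [N _]. wex (id_exists w) as i Hi.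
    assert (P : w ⊩ wPair f' i v).
    { eapply wIff_2, N; apply isPair_congr; [apply sameclass_refl|].
      now apply sameclass_eqv. }
    apply (wIff_1 _ _ _ (sameclass_eqv _ _ _ Hi g)).
    exact (pair_snd _ _ _ _ _ _ K P).
  - wex (pair_exists w f g) as p Hp. apply pairIn_i with p; auto.
    apply (wIff_2 _ _ _ (H p)), wEx_i with f; split; [|apply wEq_refl].
    eapply wIff_1, Hp; apply isPair_congr; [apply sameclass_refl|].
    now apply sameclass_eqv.
Qed.

Lemma zero_func w z : w ⊩ wIsZero z -> w ⊩ wFunc z.
Proof.
  intros H f g g'; wintro [K M].
  apply (wIff_1 _ _ _ (zero_pair _ _ _ _ H)) in K, M.
  exact (wIs_unique _ _ _ _ K M).
Qed.

Local Open Scope inf_scope.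

Definition Composite (f z u : term) : oform :=
  ∃ x w t q, u ≐ ⟨ x , w ⟩ ∧ t ∈ FUNC ∧ ⟨ f , t ⟩ ∈ z ∧ ⟨ x , q ⟩ ∈ t ∧ ⟨ q , w ⟩ ∈ f.

Definition SuccValue (z f p : term) : oform :=
  f ∈ FUNC ∧ ∀ u, u ∈ p ↔ Composite f z u.

Local Close Scope inf_scope.

Definition wComposite (f z u : nat) : wprop :=
  wEx (fun x => wEx (fun y => wEx (fun t => wEx (fun q =>
    wAnd (wPair x y u) (wAnd (wFunc t) (wAnd (wPairIn f t z)
      (wAnd (wPairIn x q t) (wPairIn q y f)))))))).

Definition wSuccValue (z f p : nat) : wprop := wAnd (wFunc f) (wIs (wComposite f z) p).

Definition wSuccOf (z : nat) : nat -> wprop :=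
  wIs (fun v => wEx (fun f => wEx (fun p => wAnd (wPair f p v) (wSuccValue z f p)))).

Definition wSuccApp (k : nat) : nat -> wprop :=
  wIs (fun t => wEx (fun y => wAnd
    (wEx (fun v => wAnd (wPair k y v)
      (wEx (fun z => wAnd (isPair (eqv z) (wSuccOf z) v) (wFunc z)))))
    (wIn t y))).

Lemma composite_exists w f z : w ⊩ wEx (wIs (wComposite f z)).
Proof.
  apply (comprehension w (scons z (scons f id)) (Composite (Var 0) (Var 1) (Var 2) 3)).
  - stratify (scons 2 (scons 6 (scons 3 (fun _ => 0)))).
  - denote.
Qed.

Lemma succOf_exists w z : w ⊩ wEx (wSuccOf z).
Proof.
  apply (comprehension w (scons z id) (t_in (Var 1) (succ_of (Var 0)) 2)).
  - stratify (scons 5 (scons 6 (fun _ => 0))).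
  - denote.
Qed.

Lemma succApp_exists w k : w ⊩ wEx (wSuccApp k).
Proof.
  apply (comprehension w (scons k id) (t_in (Var 1) (Succ · Var 0)%inf 2)).
  - stratify (scons 5 (scons 6 (fun _ => 0))).
  - denote.
Qed.

Lemma succOf_congr w z z' s : w ⊩ wEq z z' -> w ⊩ wSuccOf z s -> w ⊩ wSuccOf z' s.
Proof.
  intros E; apply (den_congr w (scons s (scons z id)) (scons s (scons z' id))
                     (t_eq (Var 1) (succ_of (Var 0)) 2)); [denote|denote|].
  intros [|[|i]]; [apply wEq_refl|exact E|apply wEq_refl].
Qed.

Lemma succValue_congr w z f p f' p' :
  w ⊩ wEq f f' -> w ⊩ wEq p p' -> w ⊩ wSuccValue z f p -> w ⊩ wSuccValue z f' p'.
Proof.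
  intros E F; apply (den_congr w (scons p (scons f (scons z id)))
    (scons p' (scons f' (scons z id))) (SuccValue (Var 0) (Var 1) (Var 2) 3)); [denote|denote|].
  intros [|[|i]]; [exact F|exact E|apply wEq_refl].
Qed.

Lemma succOf_pair w z s f p :
  w ⊩ wSuccOf z s -> w ⊩ wIff (wPairIn f p s) (wSuccValue z f p).
Proof.
  intros H; apply pairIn_is; [exact H|].
  intros v f' p' E F; exact (succValue_congr _ _ _ _ _ _ E F).
Qed.

Lemma succOf_func w z s : w ⊩ wSuccOf z s -> w ⊩ wFunc s.
Proof.
  intros H f p p'; wintro [K M].
  apply (wIff_1 _ _ _ (succOf_pair _ _ _ _ _ H)) in K, M.
  destruct K as [_ K], M as [_ M]; exact (wIs_unique _ _ _ _ K M).
Qed.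

(** [Ap] collects the members of all values, so [Succ · k] has no members unless [k] is a function;
    [wFunc k] makes [succ_of k] its one value. *)
Lemma succApp_succOf w k s : w ⊩ wFunc k -> w ⊩ wSuccApp k s -> w ⊩ wSuccOf k s.
Proof.
  intros F H. wex (succOf_exists w k) as y Hy.
  eapply wIff_1; [apply (sameclass_eqv _ _ _ Hy)|].
  apply wEq_ext; intros t; split; wintro K.
  - pose proof (wIff_1 _ _ _ (H t) K) as M; cbn beta in M.
    wex M as y' [M N]. wex M as v [M O]. wex O as z [O P].
    wex (succOf_exists w z) as y2 Hy2.
    assert (R : w ⊩ wPair z y2 v).
    { eapply wIff_2, O; apply isPair_congr; [apply sameclass_refl|].
      now apply sameclass_eqv. }
    eapply wIn_congr; [apply wEq_refl| |exact N].
    eapply wEq_trans; [exact (pair_snd _ _ _ _ _ _ M R)|].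
    eapply wIs_unique, Hy. refine (succOf_congr _ _ _ _ _ Hy2).
    exact (wEq_sym _ _ _ (pair_fst _ _ _ _ _ _ M R)).
  - apply (wIff_2 _ _ _ (H t)), wEx_i with y; split; [|exact K].
    wex (pair_exists w k y) as v Hv. apply wEx_i with v; split; [exact Hv|].
    apply wEx_i with k; split; [|exact F].
    eapply wIff_1, Hv; apply isPair_congr; [apply sameclass_refl|].
    now apply sameclass_eqv.
Qed.

(** The composite ranges over every function that [k] assigns to [f]; [wFunc k] identifies all of
    them with [t]. *)
Lemma composite_pair w f k t p x y :
  w ⊩ wFunc k -> w ⊩ wFunc t -> w ⊩ wPairIn f t k -> w ⊩ wIs (wComposite f k) p ->
  w ⊩ wIff (wPairIn x y p) (wEx (fun q => wAnd (wPairIn x q t) (wPairIn q y f))).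
Proof.
  intros Fk Ft Ht Hp; split; wintro K.
  - wex K as v [K M]. pose proof (wIff_1 _ _ _ (Hp v) M) as N; cbn beta in N.
    wex N as x' N; wex N as y' N; wex N as t' N; wex N as q [N [_ [Ht' [O P]]]].
    apply wEx_i with q; split.
    + eapply pairIn_congr; [|apply wEq_refl| |exact O].
      * exact (pair_fst _ _ _ _ _ _ N K).
      * exact (func_unique _ _ _ _ _ Fk Ht' Ht).
    + eapply pairIn_congr; [apply wEq_refl| |apply wEq_refl|exact P].
      exact (pair_snd _ _ _ _ _ _ N K).
  - wex K as q [K M]. wex (pair_exists w x y) as v Hv.
    apply pairIn_i with v; auto. apply (wIff_2 _ _ _ (Hp v)).
    apply wEx_i with x, wEx_i with y, wEx_i with t, wEx_i with q.
    exact (conj Hv (conj Ft (conj Ht (conj K M)))).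
Qed.

Lemma composite_func w f k t p :
  w ⊩ wFunc f -> w ⊩ wFunc k -> w ⊩ wFunc t -> w ⊩ wPairIn f t k ->
  w ⊩ wIs (wComposite f k) p -> w ⊩ wFunc p.
Proof.
  intros Ff Fk Ft Ht Hp x y z; wintro [K M].
  apply (wIff_1 _ _ _ (composite_pair _ _ _ _ _ _ _ Fk Ft Ht Hp)) in K, M.
  wex K as q [K1 K2]; wex M as q' [M1 M2].
  eapply func_unique; [exact Ff|exact K2|].
  eapply pairIn_congr; [|apply wEq_refl|apply wEq_refl|exact M2].
  exact (func_unique _ _ _ _ _ Ft M1 K1).
Qed.

(** The equation [n f x = y] read through pairs instead of [Ap], which yields an empty class where a
    function is undefined. *)
Definition wIter (f n x y : nat) : wprop :=
  wEx (fun g => wAnd (wPairIn f g n) (wPairIn x y g)).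

Lemma iter_value w f n g x y :
  w ⊩ wFunc n -> w ⊩ wPairIn f g n -> w ⊩ wIff (wIter f n x y) (wPairIn x y g).
Proof.
  intros F H; split; wintro K.
  - wex K as g' [K M]. eapply pairIn_congr; [apply wEq_refl|apply wEq_refl| |exact M].
    exact (func_unique _ _ _ _ _ F K H).
  - apply wEx_i with g; now split.
Qed.

Lemma iter_zero w f z x y : w ⊩ wIsZero z -> w ⊩ wIff (wIter f z x y) (wEq x y).
Proof.
  intros H; split; wintro K.
  - wex K as g [K M]. apply (wIff_1 _ _ _ (zero_pair _ _ _ _ H)) in K.
    exact (wIff_1 _ _ _ (id_pair _ _ _ _ K) M).
  - wex (id_exists w) as i Hi. apply wEx_i with i; split.
    + exact (wIff_2 _ _ _ (zero_pair _ _ _ _ H) Hi).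
    + exact (wIff_2 _ _ _ (id_pair _ _ _ _ Hi) K).
Qed.

Lemma iter_succ w f k s t x y :
  w ⊩ wFunc f -> w ⊩ wFunc k -> w ⊩ wFunc t -> w ⊩ wPairIn f t k -> w ⊩ wSuccApp k s ->
  w ⊩ wIff (wIter f s x y) (wEx (fun q => wAnd (wIter f k x q) (wPairIn q y f))).
Proof.
  intros Ff Fk Ft Ht Hs. apply succApp_succOf in Hs; [|exact Fk]. split; wintro K.
  - wex K as p [K M]. apply (wIff_1 _ _ _ (succOf_pair _ _ _ _ _ Hs)) in K.
    destruct K as [_ K].
    apply (wIff_1 _ _ _ (composite_pair _ _ _ _ _ _ _ Fk Ft Ht K)) in M.
    wex M as q [M N]. apply wEx_i with q; split; auto. apply wEx_i with t; now split.
  - wex K as q [K M]. apply (wIff_1 _ _ _ (iter_value _ _ _ _ _ _ Fk Ht)) in K.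
    wex (composite_exists w f k) as p Hp. apply wEx_i with p; split.
    + apply (wIff_2 _ _ _ (succOf_pair _ _ _ _ _ Hs)); now split.
    + apply (wIff_2 _ _ _ (composite_pair _ _ _ _ _ _ _ Fk Ft Ht Hp)).
      apply wEx_i with q; now split.
Qed.

Lemma iter_congr w f n x y n' x' y' :
  w ⊩ wEq n n' -> w ⊩ wEq x x' -> w ⊩ wEq y y' ->
  w ⊩ wIter f n x y -> w ⊩ wIter f n' x' y'.
Proof.
  intros E F G H; wex H as g [H K]. apply wEx_i with g; split.
  - exact (pairIn_congr _ _ _ _ _ _ _ (wEq_refl _ _) (wEq_refl _ _) E H).
  - exact (pairIn_congr _ _ _ _ _ _ _ F G (wEq_refl _ _) K).
Qed.

(** * Induction on [Nat] and the invariants *)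

Definition wNat (n : nat) : wprop :=
  wAll (fun X => wImp
    (wAnd (wEx (fun z => wAnd (wIsZero z) (wIn z X)))
       (wAll (fun k => wImp (wIn k X) (wEx (fun s => wAnd (wSuccApp k s) (wIn s X))))))
    (wIn n X)).

(** [Nat] is an intersection of sets, so [P] must have a set as its extension. The base and step
    cases speak of sets equal to [Zero] and [Succ · k] instead of the abstracts. *)
Lemma nat_ind w P n :
  w ⊩ wEx (fun a => wAll (fun k => wIff (wIn k a) (P k))) ->
  w ⊩ wAll (fun z => wImp (wIsZero z) (P z)) ->
  w ⊩ wAll (fun k => wAll (fun s => wImp (wAnd (P k) (wSuccApp k s)) (P s))) ->
  w ⊩ wNat n -> w ⊩ P n.
Proof.
  intros C H0 HS N; wex C as a Ha.
  apply (wIff_1 _ _ _ (Ha n)); apply (N a w (incl_refl w)); split.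
  - wex (zero_exists w) as z Hz; apply wEx_i with z; split; [exact Hz|].
    apply (wIff_2 _ _ _ (Ha z)), (H0 z w (incl_refl w) Hz).
  - intros k; wintro Hk. wex (succApp_exists w k) as s Hs.
    apply wEx_i with s; split; [exact Hs|].
    apply (wIff_2 _ _ _ (Ha s)), (HS k s w (incl_refl w)); split; [|exact Hs].
    exact (wIff_1 _ _ _ (Ha k) Hk).
Qed.

Local Open Scope inf_scope.

Definition Iter (f n x y : term) : oform := ∃ g, ⟨ f , g ⟩ ∈ n ∧ ⟨ x , y ⟩ ∈ g.

(** The two [FUNC] clauses make [iter_succ] applicable at the next number; the other clauses are
    totality, injectivity and commutation. Only totality mentions [X]: the zeroth iterate is the
    identity on the whole universe. *)
Definition Inv (X f n : term) : oform :=
  n ∈ FUNC ∧ (∃ g, g ∈ FUNC ∧ ⟨ f , g ⟩ ∈ n) ∧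
  (∀ x, x ∈ X → ∃ y, y ∈ X ∧ Iter f n x y) ∧
  (∀ x u y, Iter f n x y ∧ Iter f n u y → x ≐ u) ∧
  (∀ x y z, ⟨ x , y ⟩ ∈ f ∧ Iter f n y z → ∃ u, Iter f n x u ∧ ⟨ u , z ⟩ ∈ f).

(** A property of one set [v], since [Sum] is an intersection of sets of triples. [b] acts first
    because it is the summand on which addition recurses. *)
Definition SumRule (f v : term) : oform :=
  ∀ a b c, v ≐ ⟨ a , b , c ⟩ →
    ∀ x y z, Iter f b x y ∧ Iter f a y z → Iter f c x z.

Local Close Scope inf_scope.

Definition wTotal (X : nat) (R : nat -> nat -> wprop) : wprop :=
  wAll (fun x => wImp (wIn x X) (wEx (fun y => wAnd (wIn y X) (R x y)))).

Definition wInjective (R : nat -> nat -> wprop) : wprop :=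
  wAll (fun x => wAll (fun u => wAll (fun y =>
    wImp (wAnd (R x y) (R u y)) (wEq x u)))).

Definition wInv (X f n : nat) : wprop :=
  wAnd (wFunc n) (wAnd (wEx (fun g => wAnd (wFunc g) (wPairIn f g n)))
    (wAnd (wTotal X (wIter f n)) (wAnd (wInjective (wIter f n))
      (wAll (fun x => wAll (fun y => wAll (fun z =>
        wImp (wAnd (wPairIn x y f) (wIter f n y z))
          (wEx (fun u => wAnd (wIter f n x u) (wPairIn u z f)))))))))).

Lemma inv_exists w X f :
  w ⊩ wEx (fun a => wAll (fun n => wIff (wIn n a) (wInv X f n))).
Proof.
  apply (comprehension w (scons f (scons X id)) (Inv (Var 0) (Var 1) (Var 2) 3)).
  - stratify (scons 6 (scons 3 (fun _ => 1))).
  - denote.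
Qed.

Lemma inv_zero w X f z : w ⊩ wIsZero z -> w ⊩ wInv X f z.
Proof.
  intros H; split; [|split; [|split; [|split]]].
  - now apply zero_func.
  - wex (id_exists w) as i Hi; apply wEx_i with i; split; [now apply id_func|].
    exact (wIff_2 _ _ _ (zero_pair _ _ _ _ H) Hi).
  - intros x; wintro K; apply wEx_i with x; split; [exact K|].
    apply (wIff_2 _ _ _ (iter_zero _ _ _ _ _ H)), wEq_refl.
  - intros x u y; wintro [K M].
    apply (wIff_1 _ _ _ (iter_zero _ _ _ _ _ H)) in K, M; weq.
  - intros x y u; wintro [K M].
    apply (wIff_1 _ _ _ (iter_zero _ _ _ _ _ H)) in M.
    apply wEx_i with x; split.
    + apply (wIff_2 _ _ _ (iter_zero _ _ _ _ _ H)), wEq_refl.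
    + exact (pairIn_congr _ _ _ _ _ _ _ (wEq_refl _ _) M (wEq_refl _ _) K).
Qed.

Lemma inv_succ w X f k s :
  w ⊩ wFunc f -> w ⊩ wTotal X (fun x y => wPairIn x y f) ->
  w ⊩ wInjective (fun x y => wPairIn x y f) ->
  w ⊩ wInv X f k -> w ⊩ wSuccApp k s -> w ⊩ wInv X f s.
Proof.
  intros Ff Tf If [Fk [G [Tk [Ik Ck]]]] Hs. wex G as t [Ft Ht].
  assert (S : w ⊩ wAll (fun x => wAll (fun y =>
    wIff (wIter f s x y) (wEx (fun q => wAnd (wIter f k x q) (wPairIn q y f)))))).
  { intros x y; exact (iter_succ _ _ _ _ _ _ _ Ff Fk Ft Ht Hs). }
  pose proof (succApp_succOf _ _ _ Fk Hs) as Os.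
  split; [|split; [|split; [|split]]].
  - exact (succOf_func _ _ _ Os).
  - wex (composite_exists w f k) as p Hp; apply wEx_i with p; split.
    + exact (composite_func _ _ _ _ _ Ff Fk Ft Ht Hp).
    + apply (wIff_2 _ _ _ (succOf_pair _ _ _ _ _ Os)); now split.
  - intros x; wintro K. pose proof (wImp_e _ _ _ (Tk x) K) as M.
    wex M as q [M N]. pose proof (wImp_e _ _ _ (Tf q) M) as O.
    wex O as y [O P]. apply wEx_i with y; split; [exact O|].
    apply (wIff_2 _ _ _ (S x y)), wEx_i with q; now split.
  - intros x u y; wintro [K M]. apply (wIff_1 _ _ _ (S _ _)) in K, M.
    wex K as q [K1 K2]; wex M as r [M1 M2].
    apply (wImp_e _ _ _ (Ik x u q)); split; [exact K1|].
    refine (iter_congr _ _ _ _ _ _ _ _ (wEq_refl _ _) (wEq_refl _ _) _ M1).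
    apply (wImp_e _ _ _ (If r q y)); now split.
  - intros x y z; wintro [K M]. apply (wIff_1 _ _ _ (S _ _)) in M.
    wex M as q [M N].
    pose proof (wImp_e _ _ _ (Ck x y q) (conj K M)) as O.
    (* Since f^k x = u and f u = q, the iterate f^s x is [q] itself, and f q = z. *)
    wex O as u [O P]. apply wEx_i with q; split; [|exact N].
    apply (wIff_2 _ _ _ (S x q)), wEx_i with u; now split.
Qed.

Lemma nat_inv w X f n :
  w ⊩ wFunc f -> w ⊩ wTotal X (fun x y => wPairIn x y f) ->
  w ⊩ wInjective (fun x y => wPairIn x y f) -> w ⊩ wNat n -> w ⊩ wInv X f n.
Proof.
  intros Ff Tf If; apply nat_ind; [apply inv_exists| |].
  - intros z; wintro H; now apply inv_zero.
  - intros k s; wintro [H K]; now apply inv_succ with k.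
Qed.

(** * Addition *)

Definition isTriple (A B C : nat -> wprop) : nat -> wprop :=
  isPair (isPair A B) (wIs (wIs C)).
Definition wTriple (a b c : nat) : nat -> wprop := isTriple (eqv a) (eqv b) (eqv c).

Lemma isTriple_congr w A A' B B' C C' :
  w ⊩ sameclass A A' -> w ⊩ sameclass B B' -> w ⊩ sameclass C C' ->
  w ⊩ sameclass (isTriple A B C) (isTriple A' B' C').
Proof.
  intros H K M; apply isPair_congr; [now apply isPair_congr|].
  now apply wIs_congr, wIs_congr.
Qed.

Lemma triple_exists w a b c : w ⊩ wEx (wTriple a b c).
Proof.
  apply (comprehension w (scons c (scons b (scons a id)))
           (t_in (Var 3) (Triple (Var 0) (Var 1) (Var 2)) 4)).
  - stratify (scons 3 (fun _ => 0)).
  - denote.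
Qed.

(** Once the inner pair and both singletons are named by sets, injectivity of triples reduces to
    that of pairs and singletons. *)
Lemma triple_pair w a b c v p s t :
  w ⊩ wPair a b p -> w ⊩ wIs (eqv c) s -> w ⊩ wIs (eqv s) t ->
  w ⊩ wIff (wTriple a b c v) (wPair p t v).
Proof.
  intros Hp Hs Ht.
  assert (E : w ⊩ sameclass (wPair p t) (wTriple a b c)).
  { apply isPair_congr; [now apply sameclass_eqv|].
    assert (F : w ⊩ sameclass (wIs (eqv s)) (wIs (wIs (eqv c)))).
    { now apply wIs_congr, sameclass_eqv. }
    intros z; split; wintro K.
    - apply (wIff_1 _ _ _ (F z)), (wIff_1 _ _ _ (sameclass_eqv _ _ _ Ht z) K).
    - apply (wIff_2 _ _ _ (sameclass_eqv _ _ _ Ht z)), (wIff_2 _ _ _ (F z) K). }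
  split; wintro K; [exact (wIff_2 _ _ _ (E v) K)|exact (wIff_1 _ _ _ (E v) K)].
Qed.

Lemma sing_inj w x y s : w ⊩ wIs (eqv x) s -> w ⊩ wIs (eqv y) s -> w ⊩ wEq x y.
Proof. intros H K; exact (sing_mem _ _ _ _ K (sing_self _ _ _ H)). Qed.

Lemma triple_inj w a b c a' b' c' v :
  w ⊩ wTriple a b c v -> w ⊩ wTriple a' b' c' v ->
  w ⊩ wAnd (wEq a a') (wAnd (wEq b b') (wEq c c')).
Proof.
  intros H K.
  wex (pair_exists w a b) as p Hp; wex (pair_exists w a' b') as p' Hp'.
  wex (sing_exists w c) as s Hs; wex (sing_exists w c') as s' Hs'.
  wex (sing_exists w s) as t Ht; wex (sing_exists w s') as t' Ht'.
  apply (wIff_1 _ _ _ (triple_pair _ _ _ _ _ _ _ _ Hp Hs Ht)) in H.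
  apply (wIff_1 _ _ _ (triple_pair _ _ _ _ _ _ _ _ Hp' Hs' Ht')) in K.
  assert (P : w ⊩ wPair a' b' p).
  { exact (wIff_1 _ _ _ (sameclass_eqv _ _ _ Hp' p) (pair_fst _ _ _ _ _ _ H K)). }
  assert (T : w ⊩ wIs (eqv s') t).
  { exact (wIff_1 _ _ _ (sameclass_eqv _ _ _ Ht' t) (pair_snd _ _ _ _ _ _ H K)). }
  pose proof (sing_inj _ _ _ _ Ht T) as E.
  split; [exact (pair_fst _ _ _ _ _ _ Hp P)|split; [exact (pair_snd _ _ _ _ _ _ Hp P)|]].
  apply (sing_inj w c c' s Hs).
  exact (wIff_1 _ _ _ (sameclass_eqv _ _ _ Hs' s) E).
Qed.

Definition wTripleIn (A B C : nat -> wprop) (X : nat) : wprop :=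
  wEx (fun v => wAnd (isTriple A B C v) (wIn v X)).

Definition wSum (v : nat) : wprop :=
  wAll (fun X => wImp
    (wAnd
      (wAll (fun x => wImp (wNat x) (wTripleIn (eqv x) wIsZero (eqv x) X)))
      (wAll (fun x => wAll (fun n => wAll (fun y =>
        wImp (wAnd (wNat x) (wAnd (wNat n) (wNat y)))
          (wImp (wTripleIn (eqv x) (eqv n) (eqv y) X)
             (wTripleIn (eqv x) (wSuccApp n) (wSuccApp y) X)))))))
    (wIn v X)).

Definition wRule (f a b c : nat) : wprop :=
  wAll (fun x => wAll (fun y => wAll (fun z =>
    wImp (wAnd (wIter f b x y) (wIter f a y z)) (wIter f c x z)))).

Definition wSumRule (f v : nat) : wprop :=
  wAll (fun a => wAll (fun b => wAll (fun c =>
    wImp (wTriple a b c v) (wRule f a b c)))).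

Lemma sumRule_exists w f : w ⊩ wEx (wIs (wSumRule f)).
Proof.
  apply (comprehension w (scons f id) (SumRule (Var 0) (Var 1) 2)).
  - stratify (scons 10 (fun _ => 3)).
  - denote.
Qed.

(** By [triple_inj], a set is a triple in one way up to equality, so checking one presentation
    settles all. *)
Lemma sumRule_intro w f a b c v :
  w ⊩ wTriple a b c v -> w ⊩ wRule f a b c -> w ⊩ wSumRule f v.
Proof.
  intros H R a' b' c'; wintro K; intros x y z; wintro [M N].
  destruct (triple_inj _ _ _ _ _ _ _ _ H K) as [E [F G]].
  refine (iter_congr _ _ _ _ _ _ _ _ G (wEq_refl _ _) (wEq_refl _ _) _).
  apply (wImp_e _ _ _ (R x y z)); split.
  - exact (iter_congr _ _ _ _ _ _ _ _ (wEq_sym _ _ _ F) (wEq_refl _ _) (wEq_refl _ _) M).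
  - exact (iter_congr _ _ _ _ _ _ _ _ (wEq_sym _ _ _ E) (wEq_refl _ _) (wEq_refl _ _) N).
Qed.

Lemma rule_zero w f a z : w ⊩ wIsZero z -> w ⊩ wRule f a z a.
Proof.
  intros H x y u; wintro [K M].
  apply (wIff_1 _ _ _ (iter_zero _ _ _ _ _ H)) in K.
  exact (iter_congr _ _ _ _ _ _ _ _ (wEq_refl _ _) (wEq_sym _ _ _ K) (wEq_refl _ _) M).
Qed.

Lemma inv_iter_succ w X f k s x y :
  w ⊩ wFunc f -> w ⊩ wInv X f k -> w ⊩ wSuccApp k s ->
  w ⊩ wIff (wIter f s x y) (wEx (fun q => wAnd (wIter f k x q) (wPairIn q y f))).
Proof.
  intros Ff [Fk [G _]] Hs. wex G as t [Ft Ht].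
  exact (iter_succ _ _ _ _ _ _ _ Ff Fk Ft Ht Hs).
Qed.

(** In f^a (f (f^n x)) the new [f] sits in the middle; the commuting clause for [a] moves it
    outermost, where the successor of [b] has it. *)
Lemma rule_succ w X f a n b s t :
  w ⊩ wFunc f -> w ⊩ wInv X f a -> w ⊩ wInv X f n -> w ⊩ wInv X f b ->
  w ⊩ wSuccApp n s -> w ⊩ wSuccApp b t -> w ⊩ wRule f a n b -> w ⊩ wRule f a s t.
Proof.
  intros Ff [_ [_ [_ [_ Ca]]]] In Ib Hs Ht R x y z; wintro [K M].
  apply (wIff_1 _ _ _ (inv_iter_succ _ _ _ _ _ _ _ Ff In Hs)) in K.
  apply (wIff_2 _ _ _ (inv_iter_succ _ _ _ _ _ _ _ Ff Ib Ht)).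
  wex K as q [K N].
  pose proof (wImp_e _ _ _ (Ca q y z) (conj N M)) as O.
  wex O as u [O P]. apply wEx_i with u; split; [|exact P].
  apply (wImp_e _ _ _ (R x q u)); now split.
Qed.

Lemma sum_rule w X f a b c :
  w ⊩ wFunc f -> w ⊩ wTotal X (fun x y => wPairIn x y f) ->
  w ⊩ wInjective (fun x y => wPairIn x y f) ->
  w ⊩ wEx (fun v => wAnd (wTriple a b c v) (wSum v)) -> w ⊩ wRule f a b c.
Proof.
  intros Ff Tf If H. wex H as v [H K]. wex (sumRule_exists w f) as Z HZ.
  cut (w ⊩ wIn v Z).
  { intros M. exact (wImp_e _ _ _ (wIff_1 _ _ _ (HZ v) M a b c) H). }
  (* [Sum] lies in every set closed under its two clauses; it remains to check them for [Z]. *)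
  apply (wImp_e _ _ _ (K Z)); clear H K v a b c; split.
  - intros a; wintro N. wex (zero_exists w) as z Hz.
    wex (triple_exists w a z a) as v Hv. apply wEx_i with v; split.
    + refine (wIff_1 _ _ _ (isTriple_congr _ _ _ _ _ _ _ _ _ _ v) Hv);
        [apply sameclass_refl|now apply sameclass_eqv|apply sameclass_refl].
    + apply (wIff_2 _ _ _ (HZ v)). apply (sumRule_intro _ _ _ _ _ _ Hv).
      now apply rule_zero.
  - intros a n b; wintro [Na [Nn Nb]]; wintro H.
    wex H as v [H K].
    pose proof (wImp_e _ _ _ (wIff_1 _ _ _ (HZ v) K a n b) H) as R.
    wex (succApp_exists w n) as s Hs; wex (succApp_exists w b) as t Ht.
    wex (triple_exists w a s t) as u Hu. apply wEx_i with u; split.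
    + assert (E : w ⊩ sameclass (wTriple a s t)
                          (isTriple (eqv a) (wSuccApp n) (wSuccApp b))).
      { apply isTriple_congr; [apply sameclass_refl|exact (sameclass_eqv _ _ _ Hs)|].
        exact (sameclass_eqv _ _ _ Ht). }
      exact (wIff_1 _ _ _ (E u) Hu).
    + apply (wIff_2 _ _ _ (HZ u)). apply (sumRule_intro _ _ _ _ _ _ Hu).
      (* The [Nat] conditions in the clause of [Sum] supply the invariants of all three numbers. *)
      apply (rule_succ w X f a n b s t Ff); auto; now apply nat_inv.
Qed.

(** * Cancellation and the final statement *)

Lemma iter_fixed w X f u m x :
  w ⊩ wFunc f -> w ⊩ wTotal X (fun x y => wPairIn x y f) ->
  w ⊩ wInjective (fun x y => wPairIn x y f) ->
  w ⊩ wNat u -> w ⊩ wNat m ->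
  w ⊩ wEx (fun v => wAnd (wTriple u m u v) (wSum v)) ->
  w ⊩ wIn x X -> w ⊩ wIter f m x x.
Proof.
  intros Ff Tf If Nu Nm H K.
  pose proof (sum_rule _ _ _ _ _ _ Ff Tf If H) as R.
  destruct (nat_inv _ _ _ _ Ff Tf If Nu) as [_ [_ [Tu [Iu _]]]].
  destruct (nat_inv _ _ _ _ Ff Tf If Nm) as [_ [_ [Tm _]]].
  pose proof (wImp_e _ _ _ (Tm x) K) as L; wex L as y [L M].
  pose proof (wImp_e _ _ _ (Tu y) L) as N; wex N as z [N O].
  refine (iter_congr _ _ _ _ _ _ _ _ (wEq_refl _ _) (wEq_refl _ _) _ M).
  apply (wImp_e _ _ _ (Iu y x z)); split; [exact O|].
  apply (wImp_e _ _ _ (R x y z)); now split.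
Qed.

Lemma iter_unique w X f n x y z :
  w ⊩ wInv X f n -> w ⊩ wIter f n x y -> w ⊩ wIter f n x z -> w ⊩ wEq y z.
Proof.
  intros [Fn [G _]] K M. wex G as g [Fg Hg].
  apply (wIff_1 _ _ _ (iter_value _ _ _ _ _ _ Fn Hg)) in K, M.
  exact (func_unique _ _ _ _ _ Fg K M).
Qed.

Definition wMaps (f X Y : nat) : wprop :=
  wAll (fun x => wImp (wIn x X) (wEx (fun y => wAnd
    (wAnd (wPairIn x y f) (wAll (fun z => wImp (wPairIn x z f) (wEq z y)))) (wIn y Y)))).

Lemma maps_total w f X : w ⊩ wMaps f X X -> w ⊩ wTotal X (fun x y => wPairIn x y f).
Proof.
  intros H x; wintro K. pose proof (wImp_e _ _ _ (H x) K) as M.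
  wex M as y [[M _] N]. apply wEx_i with y; now split.
Qed.

Definition wInjection (f X : nat) : wprop :=
  wAnd (wMaps f X X)
    (wAnd (wAll (fun p => wImp (wIn p f) (wEx (fun x => wEx (fun y => wPair x y p)))))
    (wAnd (wFunc f)
    (wAnd (wAll (fun x => wImp (wEx (fun y => wPairIn x y f)) (wIn x X)))
    (wAnd (wInjective (fun x y => wPairIn x y f))
      (wAll (fun x => wAll (fun y => wImp (wAnd (wPairIn x y f) (wIn y X)) (wIn x X)))))))).

Theorem theorem12p1 :
  INF ⊢ ∀ u m, u ∈ Nat ∧ m ∈ Nat ∧ plus_is u m u →
          ∀ X f, injection f X →
            ∀ x, x ∈ X → m · f · x ≐ x.
Proof.
  unfold proves.
  match goal with |- prv _ _ ?p => rewrite <- (ren_id id p) by reflexivity end.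
  apply sem_prv.
  assert (D : den id ((∀ u m, u ∈ Nat ∧ m ∈ Nat ∧ plus_is u m u →
          ∀ X f, injection f X → ∀ x, x ∈ X → m · f · x ≐ x)%inf 0)
    (wAll (fun u => wAll (fun m =>
      wImp (wAnd (wNat u) (wAnd (wNat m)
              (wAnd (wNat u) (wEx (fun v => wAnd (wTriple u m u v) (wSum v))))))
      (wAll (fun X => wAll (fun f => wImp (wInjection f X)
      (wAll (fun x => wImp (wIn x X)
        (wAll (fun t => wIff (wEx (fun y => wAnd
           (wEx (fun p => wAnd (wPair x y p)
              (wEx (fun g => wAnd (wPairIn f g m) (wIn p g))))) (wIn t y)))
           (wIn t x)))))))))))).
  { denote. }
  (* The empty context becomes a variable so that [lift] can later replace it by larger contexts. *)
  apply D; clear D; generalize (@nil form); intros w.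
  intros u m; wintro [Nu [Nm [_ S]]]; intros X f; wintro [Mf [_ [Ff [_ [If _]]]]].
  apply maps_total in Mf.
  intros x; wintro K; intros t.
  pose proof (iter_fixed _ _ _ _ _ _ Ff Mf If Nu Nm S K) as R.
  split; wintro M.
  (* Equality with the abstract is an equivalence of members: every value [y] equals [x] by
     uniqueness, and conversely [x] is itself a value. *)
  - wex M as y [M N]; wex M as p [M O]; wex O as g [O P].
    refine (wIn_congr _ _ _ _ _ (wEq_refl _ _) _ N).
    refine (iter_unique _ _ _ _ _ _ _ (nat_inv _ _ _ _ Ff Mf If Nm) _ R).
    apply wEx_i with g; split; [exact O|now apply pairIn_i with p].
  - apply wEx_i with x; split; [|exact M].
    wex R as g [R P]. wex (pair_exists w x x) as p Hp.
    apply wEx_i with p; split; [exact Hp|]. apply wEx_i with g; split; [exact R|].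
    exact (pairIn_e _ _ _ _ _ Hp P).
Qed.
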